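(* Let $S=\beta\alpha^{-1}\underline{z}_0 \cdots \underline{z}_{n-1}\,\lambda$ be the standard representative of a string of type $\beta\alpha^{-1}\lambda$. Consider the following property $(+)$ of $S$: if there are subpatterns $U,A_1,A_2$ of $S$ such that $$S=\beta\alpha^{-1}\,U\,\underline{x}\,A_2\,\lambda\ \text{ or }\ S=\beta\alpha^{-1}\,A_1\,\underline{x}\,U\,\underline{x}\,A_2\,\lambda\ \text{ or }\ S=\beta\alpha^{-1}\,A_1\,\underline{x}\,U\,\lambda,$$ then for all subpatterns $B_1,B_2$ of $S$ we have $$S\neq\beta\alpha^{-1}\,U\,\underline{y}\,B_2\,\lambda\ \text{ and }\ S\neq\beta\alpha^{-1}\,B_1\,\underline{y}\,U\,\underline{y}\,B_2\,\lambda\ \text{ and }\ S\neq\beta\alpha^{-1}\,B_1\,\underline{y}\,U\,\lambda.$$ Then $S$ has property $(+)$ if and only if there exist a positive integer $\ell$, an $(\ell-1)$-tuple $(i_1,\ldots,i_{\ell-1})$ with $i_j\in\{0,1\}$ modulo $2$, and an $(\ell-1)$-tuple $(a_1,\ldots,a_{\ell-1})$ of positive integers such that $$S=\underline{b}^{(\ell)}\,\underline{l}^{(\ell)} \;\mbox{ or }\; S=\underline{b}^{(\ell)}\,(\underline{x}^{(\ell)})^{a_\ell}\,\underline{l}^{(\ell)} \;\mbox{ or } \; S=\underline{b}^{(\ell)}\,(\underline{y}^{(\ell)})^{a_\ell}\,\underline{l}^{(\ell)}$$ for some positive integer $a_\ell$, where $\underline{x}^{(\ell)},\underline{y}^{(\ell)},\underline{b}^{(\ell)},\underline{l}^{(\ell)}$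 are the words associated to these tuples.
   Context: Words are formal words (concatenations) in the letters $\alpha,\rho,\xi,\beta,\delta,\lambda$ and their formal inverses; these letters are the arrows of the quiver with vertices $0,1,2$, loops $\alpha,\rho,\xi$ at $0,1,2$, and arrows $\beta:0\to1$, $\delta:1\to2$, $\lambda:2\to0$. $1_0$ denotes the empty word at vertex $0$ (neutral for concatenation). Words of type $0$. $\underline{x}=\lambda\xi^{-1}\delta\beta\alpha^{-1}$ and $\underline{y}=\lambda\delta\rho^{-1}\beta\alpha^{-1}$. A word of type $0$ is $Z=1_0$ (case $n=0$) or $Z=\underline{z}_0\cdots\underline{z}_{n-1}$ with $n\ge1$ and all $\underline{z}_i\in\{\underline{x},\underline{y}\}$. A subpattern of $Z$ is $1_0$ or $\underline{z}_i\underline{z}_{i+1}\cdots\underline{z}_j$ for some $0\le i\le j\le n-1$. A word $S$ is the standard representative of a string of type $\beta\alpha^{-1}\lambda$ if $S=\beta\alpha^{-1}Z\lambda$ with $Z$ a word of type $0$; subpatterns of $S$ are the subpatterns of $Z$. Inductive words. Let $\ell$ be a positive integer, $(i_1,\dots,i_{\ell-1})$ a tuple with $i_j\in\{0,1\}$ modulo $2$, and $(a_1,\dots,a_{\ell-1})$ a tuple of positive integers. Define $N_0=\underline{x}$, $N_1=\underline{y}$, and for $1\le j\le\ell-1$ $$N_{i_1,\ldots,i_j,0}(a_1,\ldots,a_j) = N_{i_1,\ldots,i_j}(a_1,\ldots,a_{j-1})^{a_j}\,N_{i_1,\ldots,i_{j-1},(i_j)+1}(a_1,\ldots,a_{j-1}),$$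 $$N_{i_1,\ldots,i_j,1}(a_1,\ldots,a_j) = N_{i_1,\ldots,i_j}(a_1,\ldots,a_{j-1})^{a_j+1}\,N_{i_1,\ldots,i_{j-1},(i_j)+1}(a_1,\ldots,a_{j-1}),$$ where $(i_j)+1$ is taken modulo $2$. Put $$\underline{x}^{(\ell)}=N_{i_1,\ldots,i_{\ell-1},0}(a_1,\ldots,a_{\ell-1}),\qquad \underline{y}^{(\ell)}=N_{i_1,\ldots,i_{\ell-1},1}(a_1,\ldots,a_{\ell-1}),$$ $$\underline{b}^{(\ell)}=\beta\alpha^{-1}N_{i_1,0}(a_1)\,N_{i_1,i_2,0}(a_1,a_2)\cdots N_{i_1,\ldots,i_{\ell-1},0}(a_1,\ldots,a_{\ell-1}),$$ $$\underline{l}^{(\ell)}=N_{i_1,\ldots,i_{\ell-1}}(a_1,\ldots,a_{\ell-2})^{a_{\ell-1}}\cdots N_{i_1,i_2}(a_1)^{a_2}\,(N_{i_1})^{a_1}\,\lambda.$$ For $\ell=1$ (empty tuples): $\underline{x}^{(1)}=\underline{x}$, $\underline{y}^{(1)}=\underline{y}$, $\underline{b}^{(1)}=\beta\alpha^{-1}$, $\underline{l}^{(1)}=\lambda$. *)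

(* Defs.v *)
From mathcomp Require Import all_boot all_order all_algebra.
Set Implicit Arguments.
Unset Strict Implicit.
Unset Printing Implicit Defensive.
Import GRing.Theory.

Inductive arrow := Alpha | Rho | Xi | Beta | Delta | Lambda.

Inductive letter := Dir of arrow | Inv of arrow.

(* Formal words: concatenation is [++], with no cancellation of a letter
   against its inverse; the empty word 1_0 is [::]. *)
Definition word := seq letter.

Definition wpow (w : word) (k : nat) : word := flatten (nseq k w).

Definition wx : word :=
  [:: Dir Lambda; Inv Xi; Dir Delta; Dir Beta; Inv Alpha].

Definition wy : word :=
  [:: Dir Lambda; Dir Delta; Inv Rho; Dir Beta; Inv Alpha].

Definition wba : word := [:: Dir Beta; Inv Alpha].

Definition wl : word := [:: Dir Lambda].

(* The word S = beta alpha^-1 z_0 ... z_(n-1) lambda; it is the standard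
   representative of a string of type beta alpha^-1 lambda when every z_i is
   wx or wy. *)
Definition std_word n (z : n.-tuple word) : word := wba ++ flatten z ++ wl.

Definition subpattern n (z : n.-tuple word) (U : word) : Prop :=
  U = [::] \/
  exists i j : nat, i <= j < n /\ U = flatten (drop i (take j.+1 z)).

Definition property_plus n (z : n.-tuple word) : Prop :=
  let S := std_word z in
  forall U : word, subpattern z U ->
  (exists A1 A2 : word, [/\ subpattern z A1, subpattern z A2 &
     [\/ S = wba ++ U ++ wx ++ A2 ++ wl,
         S = wba ++ A1 ++ wx ++ U ++ wx ++ A2 ++ wl
       | S = wba ++ A1 ++ wx ++ U ++ wl]]) ->
  forall B1 B2 : word, subpattern z B1 -> subpattern z B2 ->
     [/\ S <> wba ++ U ++ wy ++ B2 ++ wl,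
         S <> wba ++ B1 ++ wy ++ U ++ wy ++ B2 ++ wl
       & S <> wba ++ B1 ++ wy ++ U ++ wl].

(* [Nw i a j e] is N_{i_1,...,i_j,e}(a_1,...,a_j). Sequences are indexed from
   0, so i_k is [nth 0 i k.-1] and likewise for a_k. The bit e : 'Z_2 coerces
   to nat in the exponent, giving a_j for e = 0 and a_j + 1 for e = 1; the
   sum i_j + 1 is taken modulo 2. *)
Fixpoint Nw (i : seq 'Z_2) (a : seq nat) (j : nat) (e : 'Z_2) : word :=
  match j with
  | 0 => if e == 0%R then wx else wy
  | k.+1 => wpow (Nw i a k (nth 0%R i k)) (nth 0 a k + e)
              ++ Nw i a k (nth 0%R i k + 1)%R
  end.

Definition xlev l (i : l.-1.-tuple 'Z_2) (a : l.-1.-tuple nat) : word :=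
  Nw i a l.-1 0%R.

Definition ylev l (i : l.-1.-tuple 'Z_2) (a : l.-1.-tuple nat) : word :=
  Nw i a l.-1 1%R.

(* Factors N_{i_1,...,i_j,0}(a_1,...,a_j) for j = 1, ..., l-1. *)
Definition blev l (i : l.-1.-tuple 'Z_2) (a : l.-1.-tuple nat) : word :=
  wba ++ flatten [seq Nw i a j 0%R | j <- iota 1 l.-1].

(* Factors N_{i_1,...,i_(k+1)}(a_1,...,a_k)^(a_(k+1)) for k = l-2, ..., 0. *)
Definition llev l (i : l.-1.-tuple 'Z_2) (a : l.-1.-tuple nat) : word :=
  flatten [seq wpow (Nw i a k (nth 0%R i k)) (nth 0 a k) | k <- rev (iota 0 l.-1)]
    ++ wl.

(* Main.v *)
Require Import Defs.
From mathcomp Require Import all_boot all_order all_algebra.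
(** Code a word in the blocks x, y by a boolean word (x = [false], y = [true]).
    For a letter z let D_z be the map that replaces the other letter z' by z z',
    fixes z, and finally appends z. Each D_z preserves and reflects property (+):
    an obstruction U for D_z(w) is nonempty and, as z'z' does not occur in D_z(w),
    is itself in the image of D_z. Conversely, (+) for U empty forces a nonempty
    word starting with z to lie in the image of D_z. So the words with (+) are
    those obtained from the empty word by iterating D_x and D_y, the central words
    of Sturmian combinatorics. On the other side, passing from the data
    (i_2, ...; a_2, ...) to (i_1, i_2, ...; a_1, a_2, ...) applies, up to renaming
    letters, D_z' followed by D_z a_1 times, where z = N_(i_1). *)

Set Implicit Arguments.
Unset Strict Implicit.
Unset Printing Implicit Defensive.

(** * Property (+) and the maps D_z on boolean words *)

(* [c u c] occurs in [w], where one of the two letters [c], but not both, may be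
   replaced by the corresponding end of [w]. *)
Definition enclosed (c : bool) (u w : seq bool) : Prop :=
  [\/ exists a b, w = a ++ c :: u ++ c :: b,
      exists b, w = u ++ c :: b
    | exists a, w = a ++ c :: u].

Definition separating (w : seq bool) : Prop :=
  forall u, enclosed false u w -> ~ enclosed true u w.

Fixpoint derive (z : bool) (w : seq bool) : seq bool :=
  if w is c :: w' then
    if c == z then z :: derive z w' else z :: ~~ z :: derive z w'
  else [:: z].

(** By Justin's formula, this is the iterated palindromic closure of the directive word [v]. *)
Definition central (v : seq bool) : seq bool := foldr derive [::] v.

(** The letter z that ends [derive z a] serves as the image of the z after [a]; in the next lemma it
    is the first half of the image of [~~ z]. *)
Lemma derive_cat_same z a b : derive z (a ++ z :: b) = derive z a ++ derive z b.
Proof. by elim: a => [|c a IH] /=; rewrite ?eqxx // IH; case: (c == z). Qed.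

Lemma derive_cat_other z a b :
  derive z (a ++ ~~ z :: b) = derive z a ++ ~~ z :: derive z b.
Proof. by elim: a => [|c a IH] /=; [case: z | rewrite IH; case: (c == z)]. Qed.

Lemma derive_head z w : exists t, derive z w = z :: t.
Proof. by case: w => [|c w] /=; [exists [::] | case: (c == z); eexists]. Qed.

Lemma derive_last z w : exists t, derive z w = rcons t z.
Proof.
elim: w => [|c w [t IH]] /=; first by exists [::].
by case: (c == z); rewrite IH; [exists (z :: t) | exists (z :: ~~ z :: t)].
Qed.

(** The second letter of the image tells whether the preimage starts with z, since every image
    starts with z. *)
Lemma derive_inj z : injective (derive z).
Proof.
elim=> [|c w IH] [|d v] //=.
- by have [t ->] := derive_head z v; case: (d == z).
- by have [t ->] := derive_head z w; case: (c == z).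
case: (eqVneq c z) (eqVneq d z) => [->|ncz] [->|ndz].
- by case=> /IH ->.
- by have [t ->] := derive_head z w; case; case: (z).
- by have [t ->] := derive_head z v; case; case: (z).
- by case=> /IH ->; move: ncz ndz; case: c; case: d; case: (z).
Qed.

Lemma size_derive z w : size w < size (derive z w).
Proof. by elim: w => //= c w IH; case: (c == z) => //=; apply: ltnW. Qed.

(** * The image of D_z *)

(* The letters [~~ z] added at both ends also force the word to be nonempty and
   to start and end with [z]. *)
Definition isolated (z : bool) (w : seq bool) : bool :=
  path (fun u v => (u == z) || (v == z)) (~~ z) (rcons w (~~ z)).

(** The letter at the cut doubles as the added right end of [a] and the added left end of [b]. *)
Lemma isolated_cat_other z a b :
  isolated z (a ++ ~~ z :: b) = isolated z a && isolated z b.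
Proof. by rewrite /isolated rcons_cat rcons_cons -cat_rcons cat_path last_rcons. Qed.

Lemma isolated_cat_same z a b :
  isolated z (a ++ z :: b) = isolated z (rcons a z) && isolated z (z :: b).
Proof.
rewrite /isolated !rcons_cat !rcons_cons -!cats1 !cat_path /= !eqxx.
by rewrite !orbT /= last_cat /= eqxx !andbT.
Qed.

Lemma isolatedP z w : reflect (exists w', w = derive z w') (isolated z w).
Proof.
apply: (iffP idP) => [|[w' ->]]; last first.
  elim: w' => [|c w' IH] /=; first by case: z.
  case: (c == z).
    have [t e] := derive_head z w'.
    by move: IH; rewrite e -[z :: z :: t]/([:: z] ++ z :: t) isolated_cat_same /= => ->;
       case: (z).
  by rewrite -[z :: ~~ z :: _]/([:: z] ++ ~~ z :: _) isolated_cat_other IH; case: (z).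
have [m] := ubnP (size w); elim: m w => // m IH [|c w] /=; first by case: (z).
rewrite ltnS => lt_w; rewrite /isolated /= => /andP[cz].
have -> : c = z by move: cz; case: (c); case: (z).
case: w lt_w => [|d w] lt_w hw; first by exists [::].
(* A prefix zz codes z and only its first letter is consumed; a prefix z followed by [~~ z] is
   consumed whole. *)
case: (eqVneq d z) hw => [->|dz] hw.
  have [//||w' ->] := IH (z :: w).
    by move: hw; rewrite /isolated /= !eqxx !orbT.
  by exists (z :: w'); rewrite /= eqxx.
have ed : d = ~~ z by move: dz; case: (d); case: (z).
rewrite ed in hw *.
have [||w' ->] := IH w; first exact: ltnW.
  by move: hw; rewrite /isolated /= => /andP[].
by exists (~~ z :: w'); case: (z).
Qed.

Lemma isolated_derive z w : isolated z (derive z w).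
Proof. by apply/isolatedP; exists w. Qed.

(** * Enclosed words under D_z *)

(** For c = z, the enclosing letters are the last letter of [derive z a] and the first of
    [derive z b]; otherwise they are the second letters of the images of c. *)
Lemma enclosed_derive c z u w :
  enclosed c u w -> enclosed c (derive z u) (derive z w).
Proof.
case: (eqVneq c z) => [->|ncz].
  case=> [[a [b ->]]|[b ->]|[a ->]]; rewrite !derive_cat_same.
  - have [s ->] := derive_last z a; have [t ->] := derive_head z b.
    by apply: Or31; exists s, t; rewrite cat_rcons.
  - by have [t ->] := derive_head z b; apply: Or32; exists t.
  - by have [s ->] := derive_last z a; apply: Or33; exists s; rewrite cat_rcons.
have -> : c = ~~ z by move: ncz; case: (c); case: (z).
case=> [[a [b ->]]|[b ->]|[a ->]]; rewrite !derive_cat_other.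
- by apply: Or31; exists (derive z a), (derive z b).
- by apply: Or32; exists (derive z b).
- by apply: Or33; exists (derive z a).
Qed.

(** The pieces around the enclosed word inherit [isolated], so they have preimages, and injectivity
    of D_z concludes. *)
Lemma enclosed_derive_inv c z u w :
  enclosed c (derive z u) (derive z w) -> enclosed c u w.
Proof.
have gw := isolated_derive z w.
case: (eqVneq c z) => [->|ncz].
  case=> [[a [b e]]|[b e]|[a e]]; move: gw; rewrite e.
  - rewrite isolated_cat_same => /andP[/isolatedP[a' ea]].
    rewrite -cat_cons isolated_cat_same => /andP[_ /isolatedP[b' eb]].
    apply: Or31; exists a', b'; apply: (@derive_inj z).
    by rewrite e !derive_cat_same -ea -eb cat_rcons.
  - rewrite isolated_cat_same => /andP[_ /isolatedP[b' eb]].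
    apply: Or32; exists b'; apply: (@derive_inj z).
    by rewrite e !derive_cat_same -eb.
  - rewrite isolated_cat_same => /andP[/isolatedP[a' ea] _].
    apply: Or33; exists a'; apply: (@derive_inj z).
    by rewrite e !derive_cat_same -ea cat_rcons.
have -> : c = ~~ z by move: ncz; case: (c); case: (z).
case=> [[a [b e]]|[b e]|[a e]]; move: gw; rewrite e.
- rewrite !isolated_cat_other => /and3P[/isolatedP[a' ea] _ /isolatedP[b' eb]].
  apply: Or31; exists a', b'; apply: (@derive_inj z).
  by rewrite e !derive_cat_other -ea -eb.
- rewrite isolated_cat_other => /andP[_ /isolatedP[b' eb]].
  apply: Or32; exists b'; apply: (@derive_inj z).
  by rewrite e !derive_cat_other -eb.
- rewrite isolated_cat_other => /andP[/isolatedP[a' ea] _].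
  apply: Or33; exists a'; apply: (@derive_inj z).
  by rewrite e !derive_cat_other -ea.
Qed.

Lemma enclosed_other_isolated z u w :
  isolated z w -> enclosed (~~ z) u w -> isolated z u.
Proof.
by move=> gw [[a [b e]]|[b e]|[a e]]; move: gw; rewrite e !isolated_cat_other;
  [case/and3P | case/andP | case/andP].
Qed.

Lemma separatingP z w :
  separating w <-> forall u, enclosed z u w -> ~ enclosed (~~ z) u w.
Proof. by case: z; split=> h u h1 h2; apply: (h u). Qed.

Lemma separating_derive z w : separating (derive z w) <-> separating w.
Proof.
split=> h.
  by move=> u h1 h2; apply: (h (derive z u)); apply: enclosed_derive.
apply/(separatingP z) => u h1 h2.
have /isolatedP[u' eu] := enclosed_other_isolated (isolated_derive z w) h2.
rewrite eu in h1 h2.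
by have/(separatingP z)/(_ u' (enclosed_derive_inv h1)) := h; apply;
  apply: enclosed_derive_inv h2.
Qed.

(** * Words with (+) are the central words *)

(** Some two adjacent letters are [~~ z]: either both lie in the word, or the second is the added
    right end and the word ends with [~~ z]. *)
Lemma not_isolated z w :
  ~~ isolated z (z :: w) -> enclosed (~~ z) [::] (z :: w).
Proof.
have nisol u s : ~~ path (fun u v => (u == z) || (v == z)) u s ->
    exists a b, u :: s = a ++ ~~ z :: ~~ z :: b.
  elim: s u => //= v s IH u; rewrite negb_and => /orP[|/IH[a [b ->]]].
    rewrite negb_or => uv; exists [::], s.
    by move: uv; case: (u); case: (v); case: (z).
  by exists (u :: a), b.
rewrite /isolated /= eqxx orbT /= => /nisol[a [b]].
case/lastP: b => [|b d].
  rewrite -rcons_cons -[_ ++ _]/(a ++ [:: ~~ z] ++ [:: ~~ z]) catA cats1.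
  by case/rcons_inj=> ->; apply: Or33; exists a.
rewrite -!rcons_cons -rcons_cat => /rcons_inj[-> _].
by apply: Or31; exists a, b.
Qed.

Lemma separating_centralP w : separating w <-> exists v, w = central v.
Proof.
split=> [|[v ->]]; last first.
  elim: v => [|z v IH]; last exact/separating_derive.
  by move=> u [[[|? ?] [b]]|[b]|[[|? ?]]] //; case: u.
have [m] := ubnP (size w); elim: m w => // m IH [|z w] /=; first by exists [::].
rewrite ltnS => lt_w sw.
have /isolatedP[w' e] : isolated z (z :: w).
  (* The initial z encloses the empty word, so by (+) [~~ z] cannot. *)
  apply/negPn/negP => /not_isolated; have /(separatingP z) := sw; apply.
  by apply: Or32; exists w.
have [||v ev] := IH w'; last by exists (z :: v); rewrite e ev.
  by apply: leq_trans lt_w; rewrite -[size w]/((size (z :: w)).-1) e;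
    have := size_derive z w'; case: (size (derive z w')).
by apply/(separating_derive z); rewrite -e.
Qed.

Lemma map_addb_derive b z w :
  map (addb b) (derive z w) = derive (b (+) z) (map (addb b) w).
Proof.
elim: w => //= c w IH.
by move: IH; case: b; case: c; case: z => /= ->.
Qed.

Lemma map_addb_central b v : map (addb b) (central v) = central (map (addb b) v).
Proof. by elim: v => //= z v <-; rewrite map_addb_derive. Qed.

(** * Inductive words in boolean coding *)

Definition bpow (w : seq bool) (k : nat) : seq bool := flatten (nseq k w).

Fixpoint bN (i : seq bool) (a : seq nat) (j : nat) (e : bool) : seq bool :=
  if j is k.+1 then
    bpow (bN i a k (nth false i k)) (nth 0 a k + e) ++ bN i a k (~~ nth false i k)
  else [:: e].

Definition bword (i : seq bool) (a : seq nat) (m : seq bool) : seq bool :=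
  flatten [seq bN i a j false | j <- iota 1 (size i)] ++ m ++
  flatten [seq bpow (bN i a k (nth false i k)) (nth 0 a k)
          | k <- rev (iota 0 (size i))].

(** The morphism sending each letter e to N_(z,e)(a). *)
Definition subst (z : bool) (a : nat) (w : seq bool) : seq bool :=
  flatten [seq nseq (a + e) z ++ [:: ~~ z] | e : bool <- w].

Lemma subst_cat z a u v : subst z a (u ++ v) = subst z a u ++ subst z a v.
Proof. by rewrite /subst map_cat flatten_cat. Qed.

Lemma subst_flatten z a ss :
  subst z a (flatten ss) = flatten (map (subst z a) ss).
Proof. by elim: ss => //= s ss IH; rewrite subst_cat IH. Qed.

Lemma subst_bpow z a w k : subst z a (bpow w k) = bpow (subst z a w) k.
Proof. by rewrite /bpow subst_flatten map_nseq. Qed.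

Lemma bpow1 c k : bpow [:: c] k = nseq k c.
Proof. by elim: k => //= k <-. Qed.

(** The recursion of N extends the tuples on the right; extending them on the left only changes the
    base letters, to which [subst] applies. *)
Lemma bN_cons z i b a j e : bN (z :: i) (b :: a) j.+1 e = subst z b (bN i a j e).
Proof.
elim: j e => [|j IH] e; first by rewrite /= bpow1 /subst /= cats0.
by rewrite [in RHS]/= subst_cat subst_bpow -!IH.
Qed.

(** The outer pieces are the first factor N_(z,0)(a) of b and the last factor z^a of l. *)
Definition lift_word (z : bool) (a : nat) (w : seq bool) : seq bool :=
  nseq a z ++ ~~ z :: subst z a w ++ nseq a z.

Lemma bword_cons z i b a m :
  bword (z :: i) (b :: a) (subst z b m) = lift_word z b (bword i a m).
Proof.
rewrite /bword /lift_word !subst_cat !subst_flatten -!map_comp.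
rewrite [size _]/= -[iota 0 _.+1]/(0 :: iota 1 (size i)) rev_cons.
rewrite map_rcons -cats1 flatten_cat [flatten [:: _]]/= cats0 bpow1.
rewrite -[iota 1 _.+1]/(1 :: iota 2 (size i)) map_cons [flatten (_ :: _)]/= bpow1.
rewrite (iotaDl 1 1) (iotaDl 1 0) -map_rev -!map_comp addn0.
rewrite -!catA cat1s; congr (_ ++ _ :: _ ++ _ ++ _ ++ _); congr flatten.
  by apply: eq_map => j; apply: bN_cons.
by apply: eq_map => k; rewrite -[RHS]/(subst z b (bpow _ _)) subst_bpow -bN_cons.
Qed.

(** * Inductive words are the central words *)

Lemma derive_nseq_cat z a w : derive z (nseq a z ++ w) = nseq a z ++ derive z w.
Proof. by elim: a => //= a ->; rewrite eqxx. Qed.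

(** D_z adds one z before each [~~ z], and its appended z lengthens the final run. *)
Lemma derive_lift z a w : derive z (lift_word z a w) = lift_word z a.+1 w.
Proof.
have nz : (~~ z == z) = false by case: z.
have nseqS k s : nseq k z ++ z :: s = nseq k.+1 z ++ s.
  by elim: k => //= k ->.
rewrite /lift_word derive_nseq_cat /= nz nseqS; congr (_ ++ _ :: _).
elim: w => [|e w IH].
  by rewrite /= -{1}[nseq a z]cats0 derive_nseq_cat /= nseqS cats0.
rewrite /subst /= -!/(subst _ _ _) -!catA derive_nseq_cat /= nz nseqS.
by rewrite IH.
Qed.

(** With z' = [~~ z], the factors after the initial z' are z' and zz'. Regrouping moves that z' to
    the end and leaves factors z' and z'z, the images under D_z'. *)
Lemma lift_word0 z w : lift_word z 0 w = derive (~~ z) (map (addb (~~ z)) w).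
Proof.
rewrite /lift_word /= cats0; elim: w => //= e w <-.
by case: z; case: e.
Qed.

Lemma lift_wordE z a w :
  lift_word z a w = iter a (derive z) (derive (~~ z) (map (addb (~~ z)) w)).
Proof. by elim: a => [|a IH]; [exact: lift_word0 | rewrite -derive_lift IH]. Qed.

(** The exponent k = 0 covers b l, and [c] selects the power of x or of y. *)
Definition inductive_word (w : seq bool) : Prop :=
  exists (i : seq bool) (a : seq nat) (c : bool) (k : nat),
    [/\ size a = size i, all (leq 1) a &
        w = bword i a (bpow (bN i a (size i) c) k)].

Lemma central_nseq k z : central (nseq k z) = nseq k z.
Proof.
elim: k => //= k ->.
by rewrite -[nseq k z]cats0 derive_nseq_cat /= cats0; elim: k => //= k ->.
Qed.

Lemma central_nseq_cat z k v : central (nseq k z ++ v) = iter k (derive z) (central v).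
Proof. by elim: k => //= k ->. Qed.

Lemma nseq_or_switch z v :
  (exists k, v = nseq k z) \/ (exists k v', v = nseq k z ++ ~~ z :: v').
Proof.
elim: v => [|c v IH]; first by left; exists 0.
case: (eqVneq c z) => [->|cz]; last first.
  by right; exists 0, v; rewrite /=; congr cons; move: cz; case: (c); case: (z).
by case: IH => [[k ->]|[k [v' ->]]]; [left; exists k.+1 | right; exists k.+1, v'].
Qed.

Lemma inductive_nseq k z : inductive_word (nseq k z).
Proof. by exists [::], [::], z, k; split=> //; rewrite /bword /= cats0 bpow1. Qed.

Lemma inductive_centralP w : inductive_word w <-> exists v, w = central v.
Proof.
split.
  case=> i [a [c [k [sz _ ->]]]].
  elim: i a sz => [|z i IH] [|b a] //.
    by move=> _; exists (nseq k c); rewrite central_nseq /bword /= cats0 bpow1.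
  case=> /IH[v ev]; rewrite [size _]/= bN_cons -subst_bpow bword_cons ev.
  (* By [lift_wordE], D_z is applied b times after D for [~~ z]; the renaming passes to the
     directive word. *)
  exists (nseq b z ++ ~~ z :: map (addb (~~ z)) v).
  by rewrite central_nseq_cat /= -map_addb_central lift_wordE.
case=> v ->{w}; have [m] := ubnP (size v).
elim: m v => // m IH [|z v] /=; first by move=> _; apply: (inductive_nseq 0 false).
rewrite ltnS => lt_v.
case: (nseq_or_switch z v) => [[k ->]|[k [v' ev]]].
  by have := inductive_nseq k.+1 z; rewrite -(central_nseq k.+1).
(* The first run of the directive word, of length k + 1 counting its head z, gives a positive a_1;
   the rest is renamed for the induction. *)
have -> : derive z (central v) =
    lift_word z k.+1 (central (map (addb (~~ z)) v')).
  rewrite lift_wordE -map_addb_central ev central_nseq_cat /=.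
  by congr derive; congr iter; rewrite -map_comp map_id_in // => b _ /=; rewrite addKb.
have [|i [a [c [l [sz a_gt0 ->]]]]] := IH (map (addb (~~ z)) v').
  by apply: leq_trans lt_v; rewrite size_map ev size_cat /= addnS ltnS leqW ?leq_addl.
exists (z :: i), (k.+1 :: a), c, l; split=> //=; first by rewrite sz.
by rewrite -bword_cons subst_bpow -bN_cons.
Qed.

(** * From boolean words to formal words *)

Definition enc (c : bool) : word := if c then wy else wx.

Definition encode (w : seq bool) : word := flatten (map enc w).

(** Blocks have five letters and differ at the second, inverse in x and direct in y; the lone final
    lambda falls in the default case. *)
Fixpoint decode (s : word) : seq bool :=
  match s with
  | _ :: Inv _ :: _ :: _ :: _ :: s' => false :: decode s'
  | _ :: Dir _ :: _ :: _ :: _ :: s' => true :: decode s'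
  | _ => [::]
  end.

Definition std (w : seq bool) : word := wba ++ encode w ++ wl.

Lemma std_inj : injective std.
Proof.
have dK w : decode (encode w ++ wl) = w by elim: w => //= [[]] w /= ->.
by move=> u v [e]; rewrite -[u]dK -[v]dK e.
Qed.

Lemma encode_cat u v : encode (u ++ v) = encode u ++ encode v.
Proof. by rewrite /encode map_cat flatten_cat. Qed.

Lemma encode_flatten ss : encode (flatten ss) = flatten (map encode ss).
Proof. by elim: ss => //= s ss IH; rewrite encode_cat IH. Qed.

Lemma encode_bpow w k : encode (bpow w k) = wpow (encode w) k.
Proof. by rewrite /bpow encode_flatten map_nseq. Qed.

Lemma std_cat c u b : std (u ++ c :: b) = wba ++ encode u ++ enc c ++ encode b ++ wl.
Proof. by rewrite /std encode_cat /encode /= -!catA. Qed.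

Lemma std_middle c a u b :
  std (a ++ c :: u ++ c :: b) =
  wba ++ encode a ++ enc c ++ encode u ++ enc c ++ encode b ++ wl.
Proof. by rewrite std_cat encode_cat /encode /= -!catA. Qed.

Lemma tuple_encode n (z : n.-tuple word) :
  (forall i : 'I_n, tnth z i = wx \/ tnth z i = wy) ->
  exists w, tval z = map enc w.
Proof.
move=> hz; have : forall k, k < size z -> exists c, nth [::] z k = enc c.
  move=> k; rewrite size_tuple => lt_k.
  rewrite -[k]/(val (Ordinal lt_k)) -tnth_nth.
  by case: (hz (Ordinal lt_k)) => ->; [exists false | exists true].
elim: (tval z) => [|s t IH] h; first by exists [::].
have [c /= ->] := h 0 isT.
have [k lt_k|w ->] := IH; first exact: (h k.+1 lt_k).
by exists (c :: w).
Qed.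

Section Bridge.

Variables (n : nat) (z : n.-tuple word) (w : seq bool).
Hypothesis zw : tval z = map enc w.

Lemma std_wordE : std_word z = std w.
Proof. by rewrite /std_word zw. Qed.

Lemma subpatternP U :
  subpattern z U <-> exists a u b, U = encode u /\ w = a ++ u ++ b.
Proof.
have size_w : size w = n by rewrite -(size_tuple z) zw size_map.
split.
  case=> [->|[i [j [/andP[le_ij lt_jn] ->]]]]; first by exists w, [::], [::]; rewrite !cats0.
  exists (take i (take j.+1 w)), (drop i (take j.+1 w)), (drop j.+1 w).
  by rewrite zw -map_take -map_drop catA !cat_take_drop.
case=> a [u [b [-> ew]]].
case: u ew => [|c u] ew; [by left | right].
(* The factor is [c :: u], so its last position is [size a + size u]. *)
exists (size a), (size a + size u); split.
  by rewrite leq_addr -size_w ew !size_cat /= ltn_add2l ltnS leq_addr.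
rewrite zw -map_take -map_drop ew catA -addnS take_size_cat ?size_cat //.
by rewrite drop_size_cat.
Qed.

Lemma subpattern_infix a u b : w = a ++ u ++ b -> subpattern z (encode u).
Proof. by move=> e; apply/subpatternP; exists a, u, b. Qed.

Lemma enclosed_subpattern c u : enclosed c u w -> subpattern z (encode u).
Proof.
case=> [[a [b e]]|[b e]|[a e]].
- by apply: (@subpattern_infix (rcons a c) u (c :: b)); rewrite e cat_rcons.
- exact: (@subpattern_infix [::] u (c :: b)).
- by apply: (@subpattern_infix (rcons a c) u [::]); rewrite e cats0 cat_rcons.
Qed.

Lemma enclosed_std c u : enclosed c u w ->
  exists A1 A2 : word, [/\ subpattern z A1, subpattern z A2 &
    [\/ std w = wba ++ encode u ++ enc c ++ A2 ++ wl,
        std w = wba ++ A1 ++ enc c ++ encode u ++ enc c ++ A2 ++ wl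
      | std w = wba ++ A1 ++ enc c ++ encode u ++ wl]].
Proof.
have sub0 : subpattern z [::] by left.
have subl a b : w = a ++ b -> subpattern z (encode a).
  by move=> e; apply: (@subpattern_infix [::] a b).
have subr a b : w = a ++ c :: b -> subpattern z (encode b).
  by move=> e; apply: (@subpattern_infix (rcons a c) b [::]); rewrite e cats0 cat_rcons.
case=> [[a [b e]]|[b e]|[a e]].
- exists (encode a), (encode b); split; first exact: subl e.
    by apply: (subr (a ++ c :: u)); rewrite e -catA.
  by apply: Or32; rewrite e std_middle.
(* The outer word absent from the equation is taken empty, here and in the next case. *)
- exists [::], (encode b); split=> //; first exact: subr e.
  by apply: Or31; rewrite e std_cat.
- exists (encode a), [::]; split=> //; first exact: subl e.
  by apply: Or33; rewrite e std_cat.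
Qed.

(** All subpatterns are encodings, so injectivity of [std] turns equations of formal words into
    equations of boolean words. *)
Lemma property_plusP : property_plus z <-> separating w.
Proof.
rewrite /property_plus std_wordE; split.
  move=> H u hx hy.
  have [B1 [B2 [sB1 sB2]]] := enclosed_std hy.
  have [h1 h2 h3] := H _ (enclosed_subpattern hx) (enclosed_std hx) B1 B2 sB1 sB2.
  by case.
move=> H U /subpatternP[_ [u [_ [-> _]]]] [A1 [A2 [/subpatternP[_ [a1 [_ [-> _]]]]]]].
move=> /subpatternP[_ [a2 [_ [-> _]]]] hx B1 B2.
move=> /subpatternP[_ [b1 [_ [-> _]]]] /subpatternP[_ [b2 [_ [-> _]]]].
have encx : enclosed false u w.
  case: hx; rewrite -[wx]/(enc false) -?std_middle -?std_cat => /std_inj e.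
  - by apply: Or32; exists a2.
  - by apply: Or31; exists a1, a2.
  - by apply: Or33; exists a1.
have {}H := H u encx; rewrite -[wy]/(enc true) -std_middle -!std_cat.
split=> /std_inj e; apply: H.
- by apply: Or32; exists b2.
- by apply: Or31; exists b1, b2.
- by apply: Or33; exists b1.
Qed.

End Bridge.

(** * Indices modulo 2 and conclusion *)

Definition bit (e : 'Z_2) : bool := e != 0%R.

Definition unbit (b : bool) : 'Z_2 := if b then 1%R else 0%R.

Lemma unbitK : cancel unbit bit.
Proof. by case. Qed.

Lemma bit_succ e : bit (e + 1)%R = ~~ bit e.
Proof. by case: e => [[|[|]]]. Qed.

Lemma nat_bit (e : 'Z_2) : (e : nat) = bit e.
Proof. by case: e => [[|[|]]]. Qed.

(** No bound on [k] is required: [bit] sends the default 0 to the default [false]. *)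
Lemma nth_map_bit i k : nth false (map bit i) k = bit (nth 0%R i k).
Proof.
have [le_ik|lt_ki] := leqP (size i) k; last by rewrite (nth_map 0%R).
by rewrite !nth_default ?size_map.
Qed.

Lemma NwE i a j e : Nw i a j e = encode (bN (map bit i) a j (bit e)).
Proof.
elim: j e => [|j IH] e; first by rewrite /= /encode /= cats0 /bit; case: (e == 0%R).
by rewrite /= encode_cat encode_bpow nth_map_bit -bit_succ -!IH nat_bit.
Qed.

Lemma std_bword l (i : l.-1.-tuple 'Z_2) (a : l.-1.-tuple nat) m :
  std (bword (map bit i) a m) = blev i a ++ encode m ++ llev i a.
Proof.
rewrite /std /bword /blev /llev !encode_cat !encode_flatten -!map_comp size_map size_tuple.
rewrite -!catA; congr (_ ++ flatten _ ++ _ ++ flatten _ ++ _).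
  by apply: eq_map => j; rewrite /= NwE.
by apply: eq_map => k; rewrite /= encode_bpow NwE nth_map_bit.
Qed.

Theorem proposition4p3 (n : nat) (z : n.-tuple word)
    (hz : forall i : 'I_n, tnth z i = wx \/ tnth z i = wy) :
  property_plus z <->
  exists (l : nat) (i : l.-1.-tuple 'Z_2) (a : l.-1.-tuple nat),
    [/\ 0 < l, (forall j : 'I_l.-1, 0 < tnth a j) &
      exists al : nat, 0 < al /\
        [\/ std_word z = blev i a ++ llev i a,
            std_word z = blev i a ++ wpow (xlev i a) al ++ llev i a
          | std_word z = blev i a ++ wpow (ylev i a) al ++ llev i a]].
Proof.
have [w zw] := tuple_encode hz.
apply: iff_trans (property_plusP zw) _; apply: iff_trans (separating_centralP w) _.
apply: iff_trans (iff_sym (inductive_centralP w)) _; rewrite (std_wordE zw).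
split.
  case=> i [a [c [k [sz a_gt0 ->]]]].
  have szi : size (map unbit i) = size i by rewrite size_map.
  pose i' : (size i).-tuple 'Z_2 := Tuple (introT eqP szi).
  pose a' : (size i).-tuple nat := Tuple (introT eqP sz).
  exists (size i).+1, i', a'.
  have ei : i = map bit i' by rewrite -map_comp map_id_in // => b _; apply: unbitK.
  have -> : bword i a (bpow (bN i a (size i) c) k) =
      bword (map bit i') a' (bpow (bN (map bit i') a' (size i) (bit (unbit c))) k).
    by rewrite -ei unbitK.
  split=> // [j|]; first by have /all_tnthP/(_ j) := a_gt0 : all (leq 1) a'.
  rewrite (@std_bword (size i).+1 i' a') encode_bpow -NwE.
  (* For k = 0 the form b l leaves a_l free, and 1 is chosen. *)
  case: k => [|k]; first by exists 1; split=> //; apply: Or31.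
  by exists k.+1; split=> //; case: c; [apply: Or33 | apply: Or32].
case=> l [i [a [_ a_gt0 [al [_ h]]]]].
have ind c k : std w = blev i a ++ wpow (Nw i a l.-1 c) k ++ llev i a -> inductive_word w.
  rewrite NwE -encode_bpow -std_bword => /std_inj ->.
  exists (map bit i), a, (bit c), k; rewrite size_map !size_tuple; split=> //.
  exact/all_tnthP.
(* The form b l is read as a zeroth power. *)
by case: h => h; [apply: (ind 0%R 0) | apply: ind h | apply: ind h].
Qed.
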